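(* Let $\mu$ be a function on Borel subsets of $\mathbf{S}^n$ such that (i) $\mu$ is nonnegative and countably additive; (ii) $\mu(\mathbf{S}^n)=\sigma(\mathbf{S}^n)$; (iii) $\mu(\mathbf{S}^n\setminus\omega)>\sigma(\omega^* )$ for every spherically convex $\omega\subset\mathbf{S}^n$, $\omega\ne\mathbf{S}^n$. Let $(\tilde h,\tilde\rho)\in\mathcal{A}$ be the (unique up to rescaling) pair minimizing $\mathcal{Q}$ over $\mathcal{A}$. Then there exists $\tilde\gamma\in\Gamma(\mu,\sigma)$ with $\mathcal{C}[\tilde\gamma]=\sup_{\gamma\in\Gamma(\mu,\sigma)}\mathcal{C}[\gamma]$, and $$\mathcal{Q}[\tilde h,\tilde\rho]=\mathcal{C}[\tilde\gamma].$$
   Context: $\mathbf{S}^n$ is the unit sphere in $\mathbb{R}^{n+1}$, $n\ge1$, centered at the origin; $\sigma$ is the standard Lebesgue measure on $\mathbf{S}^n$; $\omega^*=\{y\in\mathbf{S}^n:\langle x,y\rangle\le0\ \forall x\in\omega\}$. $\mathcal{A}=\{(h,\rho)\in C(\mathbf{S}^n)\times C(\mathbf{S}^n): h>0,\rho>0,\ \log h(N)-\log\rho(x)\ge\log\langle x,N\rangle$ for all $(x,N)$ with $\langle x,N\rangle>0\}$ and $\mathcal{Q}[h,\rho]=\int_{\mathbf{S}^n}\log h(N)\,d\sigma(N)-\int_{\mathbf{S}^n}\log\rho(x)\,d\mu(x)$. The cost is $c(x,N)=\log\langle x,N\rangle$ if $\langle x,N\rangle>0$ and $-\infty$ otherwise.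 $\Gamma(\mu,\sigma)$ is the set of Borel measures $\gamma$ on $\mathbf{S}^n\times\mathbf{S}^n$ with $\gamma[U\times\mathbf{S}^n]=\mu[U]$ and $\gamma[\mathbf{S}^n\times U]=\sigma[U]$ for all Borel $U\subset\mathbf{S}^n$, and $\mathcal{C}[\gamma]=\int_{\mathbf{S}^n}\int_{\mathbf{S}^n}c(x,N)\,d\gamma(x,N)$. *)

(* Defs.v *)
From HB Require Import structures.
From mathcomp Require Import all_boot all_order all_algebra.
From mathcomp Require Import all_classical all_reals all_analysis.
Set Implicit Arguments. Unset Strict Implicit. Unset Printing Implicit Defensive.
Import Order.TTheory GRing.Theory Num.Theory.
Import numFieldNormedType.Exports.
Local Open Scope classical_set_scope.
Local Open Scope ring_scope.

Section Sphere.
Variables (R : realType) (n : nat).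

Definition dot (x y : 'rV[R]_(n.+1)) : R := \sum_(i < n.+1) x 0 i * y 0 i.

Definition sphere : set 'rV[R]_(n.+1) := [set x | dot x x = 1].

Definition north : 'rV[R]_(n.+1) := \row_(i < n.+1) (i == ord0)%:R.

Lemma north_sphere : sphere north.
Proof.
rewrite /sphere /= /dot (bigD1 ord0) //= big1 => [|i /negbTE ni0].
  by rewrite !mxE eqxx mulr1 addr0.
by rewrite !mxE ni0 mul0r.
Qed.

(* S^n as a type, with the subspace topology (initial topology of the inclusion). *)
Definition Sph : Type := set_type sphere.
HB.instance Definition _ := Topological.on Sph.
HB.instance Definition _ := isPointed.Build Sph (exist _ north (mem_set north_sphere)).

Definition SphM := g_sigma_algebraType (@open Sph).

Definition sv (x : Sph) : 'rV[R]_(n.+1) := set_val x.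

Definition box (a b : 'rV[R]_(n.+1)) : set 'rV[R]_(n.+1) :=
  [set x | forall i, a 0 i <= x 0 i <= b 0 i].
Definition boxvol (a b : 'rV[R]_(n.+1)) : R := \prod_(i < n.+1) (b 0 i - a 0 i).

Definition lebesgue_outer (A : set 'rV[R]_(n.+1)) : \bar R :=
  ereal_inf [set s | exists (a b : nat -> 'rV[R]_(n.+1)),
    (forall k i, a k 0 i <= b k 0 i) /\
    A `<=` \bigcup_k box (a k) (b k) /\
    s = (\sum_(0 <= k <oo) (boxvol (a k) (b k))%:E)%E].

(* Standard (surface) Lebesgue measure on S^n:
   sigma(A) = (n+1) * Leb_{n+1}({t x : 0 < t <= 1, x in A}). *)
Definition cone01 (A : set SphM) : set 'rV[R]_(n.+1) :=
  [set y | exists t (x : Sph), 0 < t <= 1 /\ A x /\ y = t *: sv x].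
Definition sigma (A : set SphM) : \bar R :=
  ((n.+1)%:R%:E * lebesgue_outer (cone01 A))%E.

Definition polar (w : set SphM) : set SphM :=
  [set y | forall x, w x -> dot (sv x) (sv y) <= 0].

Definition sph_cone (w : set SphM) : set 'rV[R]_(n.+1) :=
  [set y | exists t (x : Sph), 0 <= t /\ w x /\ y = t *: sv x].
Definition sph_convex (w : set SphM) : Prop :=
  forall u v l, sph_cone w u -> sph_cone w v -> 0 <= l <= 1 ->
    sph_cone w (l *: u + (1 - l) *: v).

Definition admissible (h rho : Sph -> R) : Prop :=
  continuous h /\ continuous rho /\
  (forall N, 0 < h N) /\ (forall x, 0 < rho x) /\
  (forall x N : Sph, 0 < dot (sv x) (sv N) ->
     ln (dot (sv x) (sv N)) <= ln (h N) - ln (rho x)).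

Definition Qfun (mu : set SphM -> \bar R) (h rho : Sph -> R) : \bar R :=
  (\int[sigma]_(N in [set: SphM]) (ln (h N))%:E
   - \int[mu]_(x in [set: SphM]) (ln (rho x))%:E)%E.

Definition cost (p : SphM * SphM) : \bar R :=
  if 0 < dot (sv p.1) (sv p.2) then (ln (dot (sv p.1) (sv p.2)))%:E else -oo%E.

Definition couplings (mu : set SphM -> \bar R) :
    set {measure set (SphM * SphM) -> \bar R} :=
  [set g | forall U : set SphM, measurable U ->
     g (U `*` setT) = mu U /\ g (setT `*` U) = sigma U].

Definition Cost (g : {measure set (SphM * SphM) -> \bar R}) : \bar R :=
  \int[g]_(p in [set: SphM * SphM]) cost p.

End Sphere.

(* Main.v *)
(** Replacing [h] by the support function [N |-> max_x rho x <x, N>] does not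
    change the value of the functional.  Two points [x] of maximality for the same
    normal [N] are two subgradients of a convex function, so their coordinates
    can differ only on countably many sets each of which meets every line
    parallel to some axis at most once; translating such a set along the axis gives
    infinitely many disjoint copies in a bounded box, hence it is null.  Thus
    almost every [N] has a single contact point [T N].  Perturbing [rho] into
    [rho * exp (t phi)], with [phi] a cutoff of a closed set [F], minimality gives
    [mu F <= sigma (T^-1 F)], and equality of the total masses turns this into
    [T_* sigma = mu].  The coupling [(T, id)_* sigma] lives on the contact set, where
    the cost equals [log h - log rho]; any other coupling has smaller cost. *)
Require Import Defs.
From HB Require Import structures.
From mathcomp Require Import all_boot all_order all_algebra.
From mathcomp Require Import all_classical all_reals all_analysis.
From mathcomp Require Import measurable_realfun.
From mathcomp Require Import ring lra.
Import Order.TTheory GRing.Theory Num.Theory.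
Import numFieldNormedType.Exports.
Local Open Scope classical_set_scope.
Local Open Scope ring_scope.
Set Implicit Arguments. Unset Strict Implicit.

(** * The outer measure given by closed boxes *)

Section LebesgueOuter.
Context {R : realType} {n : nat}.
Local Notation V := 'rV[R]_(n.+1).
Implicit Types (a b x y v : V) (i : 'I_n.+1).

(** Each corner of one box lies in the other. Hence the volume of a nonempty box depends only on the
    underlying set, as [box_content] requires. *)
Lemma box_inj a b a' b' : (forall i, a 0 i <= b 0 i) ->
  (forall i, a' 0 i <= b' 0 i) -> box a b = box a' b' -> a = a' /\ b = b'.
Proof.
move=> ab ab' e.
have a1 : box a' b' a by rewrite -e => i; rewrite lexx ab.
have b1 : box a' b' b by rewrite -e => i; rewrite lexx ab.
have a2 : box a b a' by rewrite e => i; rewrite lexx ab'.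
have b2 : box a b b' by rewrite e => i; rewrite lexx ab'.
by split; apply/rowP => i; apply/eqP; rewrite eq_le;
  have := a1 i; have := b1 i; have := a2 i; have := b2 i; lra.
Qed.

Lemma boxvol_ge0 a b : (forall i, a 0 i <= b 0 i) -> 0 <= boxvol a b.
Proof. by move=> ab; apply: prodr_ge0 => i _; rewrite subr_ge0. Qed.

Lemma boxvol0 : boxvol (0 : V) 0 = 0.
Proof. by rewrite /boxvol (bigD1 ord0)//= subrr mul0r. Qed.

(* Nonempty sets other than boxes get infinite mass, which makes them useless in
   the covers defining [mu_ext]. *)
Definition box_content (A : set V) : \bar R :=
  if `[< A = set0 >] then 0%E else
  ereal_inf [set (boxvol p.1 p.2)%:E | p in
    [set p : V * V | (forall i, p.1 0 i <= p.2 0 i) /\ A = box p.1 p.2]].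

Lemma box_content0 : box_content set0 = 0%E.
Proof. by rewrite /box_content asboolT. Qed.

Lemma box_content_ge0 A : (0 <= box_content A)%E.
Proof.
rewrite /box_content; case: ifP => // _.
by apply: le_ereal_inf_tmp => _ [p [p12 _] <-]; rewrite lee_fin boxvol_ge0.
Qed.

Lemma box_contentE a b : (forall i, a 0 i <= b 0 i) ->
  box_content (box a b) = (boxvol a b)%:E.
Proof.
move=> ab; rewrite /box_content asboolF; last first.
  by apply/eqP/set0P; exists a => i; rewrite lexx ab.
rewrite -[RHS]ereal_inf1; congr ereal_inf; apply/seteqP;
  split => [_ [[a' b'] /= [ab' e] <-]|_ ->].
  by have [<- <-] := box_inj ab ab' e.
by exists (a, b).
Qed.

Lemma box_content_pinfty A : A !=set0 ->
  ~ (exists a b, (forall i, a 0 i <= b 0 i) /\ A = box a b) ->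
  box_content A = +oo%E.
Proof.
move=> A0 nA; rewrite /box_content asboolF; last by move=> A00; move: A0;
  rewrite A00 => -[].
rewrite (_ : [set _ | _ in _] = set0) ?ereal_inf0// -subset0 => _ [[a b] /= [ab e] _].
by apply: nA; exists a, b.
Qed.

(** With every set declared measurable, [mu_ext] ranges over covers by arbitrary sets, and the
    selection of boxes is left to [box_content]. *)
Local Notation dV := (g_sigma_algebraType [set: set V]).

(** Makes the general theory of outer extensions applicable. A box cover has the same total for both
    sides; conversely, a cover with a nonempty piece that is not a box has infinite total, and any
    other cover is a box cover once its empty pieces are replaced. *)
Lemma lebesgue_outerE :
  @lebesgue_outer R n = mu_ext (box_content : set dV -> \bar R).
Proof.
apply/funext => A; apply/eqP; rewrite eq_le; apply/andP; split; last first.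
  apply: le_ereal_inf_tmp => _ [a [b [ab [AB ->]]]].
  apply: ereal_inf_lbound; exists (fun k => box (a k) (b k)); last first.
    by apply: eq_eseriesr => k _; rewrite box_contentE.
  by split => // k; exact: sub_sigma_algebra.
apply: le_ereal_inf_tmp => _ [F [_ AF] <-].
have [Fbox|/existsNP[k Fk]] := pselect (forall k, F k !=set0 ->
    exists p : V * V, (forall i, p.1 0 i <= p.2 0 i) /\ F k = box p.1 p.2).
  have /choice[p pP] : forall k, exists p : V * V, (forall i, p.1 0 i <= p.2 0 i) /\
      F k `<=` box p.1 p.2 /\ box_content (F k) = (boxvol p.1 p.2)%:E.
    move=> k; have [->|/set0P Fk0] := eqVneq (F k) set0.
      (* An empty piece is replaced by the degenerate box at the origin, of volume zero because
         there is at least one coordinate. *)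
      exists (0, 0); split => [i //|]; split; first exact: sub0set.
      by rewrite box_content0 boxvol0.
    have [p [p12 ->]] := Fbox k Fk0.
    by exists p; split => //; split => //; rewrite box_contentE.
  apply: ereal_inf_lbound; exists (fun k => (p k).1), (fun k => (p k).2).
  split; [|split].
  - by move=> k i; have [] := pP k.
  - by move=> x /AF[k _ Fkx]; exists k => //; have [_ [+ _]] := pP k; exact.
  - by apply: eq_eseriesr => k _; have [_ [_ ->]] := pP k.
rewrite (eseries_pinfty _ (k := k)) ?leey//.
  by move=> j _; rewrite -ltNye (lt_le_trans _ (box_content_ge0 _)).
move/not_implyP : Fk => [F0 nF]; apply: box_content_pinfty => // -[a [b abF]].
by apply: nF; exists (a, b).
Qed.

Lemma lebesgue_outer0 : lebesgue_outer (set0 : set V) = 0%E.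
Proof. by rewrite lebesgue_outerE; apply: mu_ext0;
  [exact: box_content0|exact: box_content_ge0]. Qed.

Lemma lebesgue_outer_ge0 A : (0 <= lebesgue_outer (A : set V))%E.
Proof. by rewrite lebesgue_outerE; apply: mu_ext_ge0; exact: box_content_ge0. Qed.

Lemma le_lebesgue_outer :
  {homo @lebesgue_outer R n : A B / A `<=` B >-> (A <= B)%E}.
Proof. by move=> A B AB; rewrite lebesgue_outerE; exact: le_mu_ext. Qed.

Lemma lebesgue_outer_sigma_subadditive : sigma_subadditive (@lebesgue_outer R n).
Proof.
rewrite lebesgue_outerE.
exact: (@mu_ext_sigma_subadditive _ dV R box_content box_content_ge0).
Qed.

HB.instance Definition _ := isOuterMeasure.Build R V (@lebesgue_outer R n)
  lebesgue_outer0 lebesgue_outer_ge0 le_lebesgue_outer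
  lebesgue_outer_sigma_subadditive.

Lemma lebesgue_outer_box a b : (forall i, a 0 i <= b 0 i) ->
  (lebesgue_outer (box a b) <= (boxvol a b)%:E)%E.
Proof.
move=> ab; rewrite lebesgue_outerE -box_contentE//.
pose F (k : nat) : set V := if k is 0%N then box a b else set0.
apply: ereal_inf_lbound; exists F.
  by split => [k|x abx]; [exact: sub_sigma_algebra|exists 0%N].
rewrite nneseries_recl//; last by move=> *; exact: box_content_ge0.
by rewrite eseries0 ?adde0// => -[|k]//= _ _; rewrite box_content0.
Qed.

Definition subst_coord (x : V) i (c : R) : V := \row_j (if j == i then c else x 0 j).

(** Only the factor of axis [i] changes under the cut, and the two lengths [c - a 0 i] and
    [b 0 i - c] add up to the original one. *)
Lemma boxvol_split a b i c :
  boxvol a (subst_coord b i c) + boxvol (subst_coord a i c) b = boxvol a b.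
Proof.
rewrite /boxvol (bigD1 i)//= [X in _ + X](bigD1 i)//= [RHS](bigD1 i)//= !mxE eqxx.
rewrite (eq_bigr (fun j => b 0 j - a 0 j)); last by move=> j /negbTE ji; rewrite !mxE ji.
rewrite [X in _ + _ * X](eq_bigr (fun j => b 0 j - a 0 j));
  last by move=> j /negbTE ji; rewrite !mxE ji.
by rewrite -mulrDl; congr (_ * _); ring.
Qed.

Local Notation mL := ((@lebesgue_outer R n).-cara.-measurable).

(** Cutting every box of a cover of [X] along the hyperplane yields covers of the two parts of [X]
    with the same total volume, which is the criterion of Carathéodory. *)
Lemma measurable_halfspace i c : mL [set x : V | x 0 i <= c].
Proof.
apply: le_caratheodory_measurable => X.
apply: le_ereal_inf_tmp => _ [a [b [ab [XB ->]]]].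
(* The cut [c] is clamped to the side of the [k]-th box, so that both halves have ordered corners
   even when the hyperplane misses the box. *)
pose m k := Num.max (a k 0 i) (Num.min (b k 0 i) c).
have am k : a k 0 i <= m k by rewrite /m le_max lexx.
have mb k : m k <= b k 0 i by rewrite /m ge_max ab ge_min lexx.
have abi k j : a k 0 j <= subst_coord (b k) i (m k) 0 j.
  by rewrite mxE; case: eqP => [->|].
have aib k j : subst_coord (a k) i (m k) 0 j <= b k 0 j.
  by rewrite mxE; case: eqP => [->|].
rewrite (eq_eseriesr (g := fun k => (boxvol (a k) (subst_coord (b k) i (m k)))%:E
    + (boxvol (subst_coord (a k) i (m k)) (b k))%:E)%E); last first.
  by move=> k _; rewrite -EFinD boxvol_split.
rewrite nneseriesD/=; last 2 first.
  by move=> k _ _; rewrite lee_fin boxvol_ge0.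
  by move=> k _ _; rewrite lee_fin boxvol_ge0.
apply: leeD; apply: ereal_inf_lbound.
  exists a, (fun k => subst_coord (b k) i (m k)); split => //; split => //.
  move=> x [/XB[k _ kx] /= xc]; exists k => // j; rewrite mxE.
  case: eqP => [->|]// ; have /andP[-> xb] := kx i.
  by rewrite /= /m le_max le_min xb xc orbT.
exists (fun k => subst_coord (a k) i (m k)), b; split => //; split => //.
move=> x [/XB[k _ kx] /negP]; rewrite -ltNge => xc; exists k => // j; rewrite mxE.
case: eqP => [->|]// ; have /andP[xa ->] := kx i.
by rewrite /m ge_max xa ge_min (ltW xc) orbT.
Qed.

End LebesgueOuter.

Lemma continuous_sumr {R : realType} {T : topologicalType} (I : finType)
    (f : I -> T -> R) : (forall i, continuous (f i)) ->
  continuous (fun y => \sum_i f i y).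
Proof.
by move=> cf; apply: continuous_big => // x; exact: add_continuous.
Qed.

(** * Borel sets, translations and null sets in Euclidean space *)

Section Borel.
Context {R : realType} {n : nat}.
Local Notation V := 'rV[R]_(n.+1).
Implicit Types (a b x y v : V) (i : 'I_n.+1).

Definition halfspaces : set (set V) :=
  [set H | exists i c, H = [set x : V | x 0 i <= c]].

(** An open set is the countable union of the rational boxes it contains. The boxes are half-open
    because they then are finite intersections of differences of half-spaces. *)
Lemma open_halfspaces (O : set V) : open O -> <<s halfspaces >> O.
Proof.
move=> oO; pose W := g_sigma_algebraType halfspaces.
have mH i c : measurable ([set x : V | x 0 i <= c] : set W).
  by apply: sub_sigma_algebra; exists i, c.
pose hbox (p : {ffun 'I_n.+1 -> rat * rat}) : set V :=
  [set x | forall i, ratr (p i).1 < x 0 i <= ratr (p i).2].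
pose F p : set W := if `[< hbox p `<=` O >] then hbox p else set0.
have -> : O = \bigcup_p F p.
  apply/seteqP; split => [x Ox|x [p _]]; last first.
    by rewrite /F; case: asboolP => // + px; exact.
  have /nbhs_ballP[e /= e0 xeO] : nbhs x O by exact: open_nbhs_nbhs.
  have /choice[q qP] : forall i, exists q : rat * rat,
      (x 0 i - e < ratr q.1 < x 0 i) /\ (x 0 i < ratr q.2 < x 0 i + e).
    move=> i.
    have /rat_in_itvoo[r1] : x 0 i - e < x 0 i by rewrite ltrBlDr ltrDl.
    have /rat_in_itvoo[r2] : x 0 i < x 0 i + e by rewrite ltrDl.
    by rewrite !in_itv/= => ? ?; exists (r1, r2).
  exists (finfun q) => //; rewrite /F asboolT.
    by move=> i; rewrite ffunE; have := qP i; lra.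
  move=> y hy; apply: xeO; split=> // k j; rewrite (ord1 k) /ball /=.
  have := hy j; rewrite ffunE; have := qP j; rewrite ltr_norml; lra.
apply: (@countable_bigcupT_measurable _ W) => //.
move=> p; rewrite /F; case: ifP => _; last exact: measurable0.
rewrite (_ : hbox p = \bigcap_i ([set x : V | x 0 i <= ratr (p i).2] `\`
    [set x : V | x 0 i <= ratr (p i).1])); last first.
  apply/seteqP; split=> [x px i _ /=|x px i].
    by have /andP[? ?] := px i; split => //; apply/negP; rewrite -ltNge.
  by have [/= -> /negP] := px i I; rewrite -ltNge => ->.
apply: fin_bigcap_measurable => // i _; apply: measurableD; exact: mH.
Qed.

Local Notation mL := ((@lebesgue_outer R n).-cara.-measurable).

Definition lebesgue_caratheodory :
    {measure set (caratheodory_type (@lebesgue_outer R n)) -> \bar R} :=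
  let mu : {outer_measure set V -> \bar R} := @lebesgue_outer R n in
  (mu : set (caratheodory_type mu) -> \bar R).

Lemma open_lebesgue_measurable (O : set V) : open O -> mL O.
Proof.
move=> /open_halfspaces; apply: (smallest_sub (G := halfspaces)).
- exact: sigma_algebra_measurable.
- by move=> _ [i [c ->]]; exact: measurable_halfspace.
Qed.

Lemma closed_lebesgue_measurable (C : set V) : closed C -> mL C.
Proof.
by move=> cC; rewrite -[C]setCK; apply: measurableC; apply: open_lebesgue_measurable;
  rewrite openC.
Qed.

Lemma lebesgue_outer_shift v (A : set V) :
  lebesgue_outer [set x | A (x - v)] = lebesgue_outer A.
Proof.
suff le (w : V) (B : set V) : (lebesgue_outer [set x : V | B (x - w)%R] <= lebesgue_outer B)%E.
  apply/eqP; rewrite eq_le le/=.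
  have := le (- v) [set x : V | A (x - v)%R].
  rewrite [X in (lebesgue_outer X <= _)%E](_ : _ = A)//.
  by apply/funext => x /=; rewrite opprK addrK.
apply: le_ereal_inf_tmp => _ [a [b [ab [Bab ->]]]].
apply: ereal_inf_lbound; exists (fun k => a k + w), (fun k => b k + w).
split; first by move=> k i; rewrite !mxE lerD2r.
split; last first.
  apply: eq_eseriesr => k _; congr (_%:E); apply: eq_bigr => i _.
  by rewrite !mxE; ring.
move=> x /= /Bab[k _ kx]; exists k => // i; have := kx i; rewrite !mxE.
by rewrite lerBrDr lerBlDr.
Qed.

Lemma box_lebesgue_lty a b : (forall i, a 0 i <= b 0 i) ->
  (lebesgue_outer (box a b) < +oo)%E.
Proof. by move=> ab; rewrite (le_lt_trans (lebesgue_outer_box ab))// ltry. Qed.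

(* Infinitely many translates of [G] along the axis are disjoint and share a bounded box. *)
Lemma lebesgue_outer_thin i (G : set V) : closed G ->
  G `<=` box (const_mx (-1)) (const_mx 1) ->
  (forall x s, 0 < s -> G x -> ~ G (x + s *: delta_mx 0 i)) ->
  lebesgue_outer G = 0%E.
Proof.
move=> cG Gb Gi; set e := delta_mx 0 i in Gi.
(* The shifts are distinct and lie in (0, 1]: the translates of [G] stay in the cube with sides
   [-1, 2], and a point common to two of them would give two points of [G] on one line parallel to
   the axis. *)
pose t (k : nat) : R := k.+1%:R^-1.
pose F k : set V := [set x | G (x - t k *: e)].
have cF k : closed (F k).
  apply: (closed_comp _ cG) => x _.
  by apply: (@cvgB _ _ _ (nbhs x) _ id (cst (t k *: e)) x (t k *: e));
    [exact: cvg_id|exact: cvg_cst].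
have t01 k : 0 < t k <= 1.
  by rewrite invr_gt0 ltr0n/= invf_le1 ?ler1n ?ltr0n.
have tF : trivIset setT F.
  have key j k x : (j < k)%N -> F j x -> F k x -> False.
    move=> jk Fj Fk; apply: (Gi _ (t j - t k) _ Fj).
      by rewrite subr_gt0 ltf_pV2 ?posrE ?ltr0n// ltr_nat.
    by rewrite scalerBl addrA subrK.
  apply/trivIsetP => j k _ _ jk; apply/seteqP; split => // x [Fj Fk].
  by case: (ltngtP j k) jk => // [jk|kj] _; [exact: (key j k x)|exact: (key k j x)].
have FE k : lebesgue_outer (F k) = lebesgue_outer G by exact: lebesgue_outer_shift.
pose B : set V := box (const_mx (-1)) (const_mx 2).
have Bab j : (const_mx (-1) : V) 0 j <= (const_mx 2 : V) 0 j.
  by rewrite !mxE; lra.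
have FB : \bigcup_k F k `<=` B.
  move=> x [k _ /Gb kx] j; have := kx j; have := t01 k; rewrite !mxE/=.
  by case: (j == i); rewrite /= ?mulr1 ?mulr0; lra.
have le_sum K : (\sum_(0 <= k < K) lebesgue_outer G <= lebesgue_outer B)%E.
  apply: le_trans (le_lebesgue_outer FB).
  rewrite -[leRHS]/(lebesgue_caratheodory _) measure_semi_bigcup//; last 2 first.
  - by move=> k; exact: closed_lebesgue_measurable.
  - by apply: bigcupT_measurable => k; exact: closed_lebesgue_measurable.
  rewrite (eq_eseriesr (g := fun=> lebesgue_outer G)); last by move=> k _; exact: FE.
  by apply: nneseries_lim_ge => *; exact: lebesgue_outer_ge0.
have Boo := box_lebesgue_lty Bab.
have Goo : lebesgue_outer G \is a fin_num.
  rewrite ge0_fin_numE ?lebesgue_outer_ge0//; apply: le_lt_trans Boo.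
  by have := le_sum 1%N; rewrite big_nat1.
have Bfin : lebesgue_outer B \is a fin_num.
  by rewrite ge0_fin_numE ?lebesgue_outer_ge0.
move: le_sum (lebesgue_outer_ge0 G); rewrite -(fineK Goo) -(fineK Bfin).
move: (fine _) (fine _) => c g gc; rewrite lee_fin le_eqVlt => /predU1P[<-//|g0].
have c0 : 0 <= c by have := gc 0%N; rewrite big_geq ?lee_fin.
(* If the mass [g] were positive, more than [c / g] disjoint translates would exceed the finite mass
   [c] of the cube. *)
have := gc (Num.bound (c / g)); rewrite sumEFin lee_fin sumr_const_nat subn0.
rewrite -[_ *+ _]mulr_natr leNgt => /negP[].
rewrite mulrC -ltr_pdivrMr//; exact: archi_boundP (divr_ge0 c0 (ltW g0)).
Qed.

End Borel.

(** * Continuous real functions and the sets they define *)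

Section ContinuousReal.
Context {R : realType} {T : topologicalType}.
Implicit Types f g : T -> R.

Lemma continuous_mul f g : continuous f -> continuous g ->
  continuous (fun x => f x * g x).
Proof. by move=> cf cg x; exact: (continuousM (cf x) (cg x)). Qed.

Lemma continuous_sub f g : continuous f -> continuous g ->
  continuous (fun x => f x - g x).
Proof. by move=> cf cg x; exact: (continuousB (cf x) (cg x)). Qed.

Lemma continuous_add f g : continuous f -> continuous g ->
  continuous (fun x => f x + g x).
Proof. by move=> cf cg x; exact: (continuousD (cf x) (cg x)). Qed.

Lemma continuous_norm f : continuous f -> continuous (fun x => `|f x|).
Proof. by move=> cf x; exact: (cvg_norm (cf x)). Qed.

Lemma closed_fun_le f g : continuous f -> continuous g ->
  closed [set x | f x <= g x].
Proof.
move=> cf cg; rewrite (_ : mkset _ = (fun x => f x - g x) @^-1` [set y | y <= 0]).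
  exact: (continuous_closedP _).1 (continuous_sub cf cg) _ (@closed_le _ 0).
by apply/funext => x /=; rewrite subr_le0.
Qed.

Lemma closed_fun_eq f g : continuous f -> continuous g ->
  closed [set x | f x = g x].
Proof.
move=> cf cg; rewrite (_ : mkset _ = [set x | f x <= g x] `&` [set x | g x <= f x]).
  by apply: closedI; exact: closed_fun_le.
apply/funext => x /=; apply/propext; split => [->|[? ?]]; first by rewrite lexx.
by apply/eqP; rewrite eq_le; apply/andP.
Qed.

Lemma open_fun_gt f c : continuous f -> open [set x | c < f x].
Proof. by move=> /continuousP cf; exact: cf (@open_gt _ c). Qed.

Lemma continuous_maxr f g : continuous f -> continuous g ->
  continuous (fun x => Num.max (f x) (g x)).
Proof.
move=> cf cg; under eq_fun do rewrite maxr_absE.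
apply: continuous_mul; last exact: cst_continuous.
apply: continuous_add; first exact: continuous_add.
by apply: continuous_norm; exact: continuous_sub.
Qed.

Lemma continuous_minr f g : continuous f -> continuous g ->
  continuous (fun x => Num.min (f x) (g x)).
Proof.
move=> cf cg; under eq_fun do rewrite minr_absE.
apply: continuous_mul; last exact: cst_continuous.
apply: continuous_sub; first exact: continuous_add.
by apply: continuous_norm; exact: continuous_sub.
Qed.

Lemma continuous_ln_comp f : continuous f -> (forall x, 0 < f x) ->
  continuous (fun x => ln (f x)).
Proof. by move=> cf f0 x; apply: continuous_comp; [exact: cf|exact: continuous_ln]. Qed.

Lemma continuous_expR_comp f : continuous f -> continuous (fun x => expR (f x)).
Proof. by move=> cf x; apply: continuous_comp; [exact: cf|exact: continuous_expR]. Qed.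

(** A squeeze at [y]: the bound [d y] is continuous and vanishes there. *)
Lemma continuous_dominated f (d : T -> T -> R) :
  (forall y, continuous (d y)) -> (forall y, d y y = 0) ->
  (forall y z, `|f y - f z| <= d y z) -> continuous f.
Proof.
move=> cd d0 fd y; apply/cvgrPdist_lt => e e0.
have /cvgrPdist_lt/(_ e e0) := cd y y.
apply: filterS => z; rewrite d0 sub0r normrN => dz.
by apply: le_lt_trans (fd y z) _; apply: le_lt_trans (ler_norm _) dz.
Qed.

End ContinuousReal.

(** * The surface measure and the topology of the sphere *)

Section SurfaceMeasure.
Context {R : realType} {n : nat}.
Local Notation V := 'rV[R]_(n.+1).
Local Notation S := (Sph R n).
Local Notation SM := (SphM R n).
Implicit Types (x y z : V) (i : 'I_n.+1) (N : S).

Lemma dotDr x y z : dot x (y + z) = dot x y + dot x z.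
Proof. by rewrite /dot -big_split; apply: eq_bigr => i _; rewrite mxE mulrDr. Qed.

Lemma dotC x y : dot x y = dot y x.
Proof. by apply: eq_bigr => i _; rewrite mulrC. Qed.

Lemma dotZr t x y : dot x (t *: y) = t * dot x y.
Proof. by rewrite /dot mulr_sumr; apply: eq_bigr => i _; rewrite mxE; ring. Qed.

Lemma dotZl t x y : dot (t *: x) y = t * dot x y.
Proof. by rewrite dotC dotZr dotC. Qed.

Lemma dot_delta x i : dot x (delta_mx 0 i) = x 0 i.
Proof.
rewrite /dot (bigD1 i)//= mxE !eqxx mulr1 big1 ?addr0// => j /negbTE ji.
by rewrite mxE ji mulr0.
Qed.

Lemma dot_coord_le x i : x 0 i ^+ 2 <= dot x x.
Proof.
rewrite /dot (bigD1 i)//= -expr2 lerDl.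
by apply: sumr_ge0 => j _; rewrite -expr2 sqr_ge0.
Qed.

Lemma dot_sv N : dot (sv N) (sv N) = 1.
Proof. by have := set_mem (proj2_sig N). Qed.

Lemma sv_coord_le1 N i : `|sv N 0 i| <= 1.
Proof.
by have := dot_coord_le (sv N) i; rewrite dot_sv => h; apply/ler_normlP; split; nra.
Qed.

Lemma sv_inj : injective (@sv R n).
Proof. by move=> N N'; exact: val_inj. Qed.

Lemma sv_continuous : continuous (@sv R n).
Proof. exact: initial_continuous. Qed.

Lemma continuous_sv_coord i : continuous (fun N => sv N 0 i).
Proof.
move=> N; apply: (@continuous_comp _ _ _ (@sv R n) (fun y : V => y 0 i)).
  exact: sv_continuous.
exact: coord_continuous.
Qed.

Lemma continuous_dot_self : continuous (fun x : V => dot x x).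
Proof.
by apply: continuous_sumr => i; apply: continuous_mul; exact: coord_continuous.
Qed.

Lemma measurable_open_Sph (O : set S) : open O -> measurable (O : set SM).
Proof. exact: sub_sigma_algebra. Qed.

Lemma measurable_closed_Sph (C : set S) : closed C -> measurable (C : set SM).
Proof.
by move=> cC; rewrite -[C]setCK; apply: measurableC; apply: measurable_open_Sph;
  rewrite openC.
Qed.

Definition sph_halfspaces : set (set SM) :=
  [set H | exists i c, H = [set N | sv N 0 i <= c]].

(** Open sets of the sphere are traces of open sets of the ambient space, which half-spaces
    generate. Properties of Borel sets can thus be checked on coordinate caps. *)
Lemma measurable_SphE : (measurable : set (set SM)) = <<s sph_halfspaces >>.
Proof.
apply/seteqP; split; apply: smallest_sub.
- exact: smallest_sigma_algebra.
- move=> _ [ O oO <-].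
  pose f : g_sigma_algebraType sph_halfspaces -> g_sigma_algebraType (@halfspaces R n) := @sv R n.
  have mf : measurable_fun setT f.
    apply: (@measurability _ _ _ _ setT f (@halfspaces R n)) => // _ [_ [i [c ->]] <-].
    by rewrite setTI; apply: sub_sigma_algebra; exists i, c.
  have := mf measurableT O (open_halfspaces oO); rewrite setTI; exact.
- exact: sigma_algebra_measurable.
- move=> _ [i [c ->]]; apply: measurable_closed_Sph.
  apply: closed_fun_le; [exact: continuous_sv_coord|exact: cst_continuous].
Qed.

Lemma cone01_scale t (A : set SM) N : 0 < t <= 1 -> A N -> cone01 A (t *: sv N).
Proof. by move=> t01 AN; exists t, N. Qed.

Lemma scale_sv_inj t t' (N N' : S) : 0 < t -> 0 < t' ->
  t *: sv N = t' *: sv N' -> t = t' /\ N = N'.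
Proof.
move=> t0 t0' e.
have tt' : t = t'.
  have : dot (t *: sv N) (t *: sv N) = dot (t' *: sv N') (t' *: sv N') by rewrite e.
  rewrite !(dotZl, dotZr) !dot_sv !mulr1 -!expr2 => /eqP.
  by rewrite eqrXn2 ?ltW// => /eqP.
split => //; apply: sv_inj; move: e; rewrite tt' => /(congr1 ( *:%R t'^-1)).
by rewrite !scalerA mulVf ?gt_eqF// !scale1r.
Qed.

Lemma cone01P (A : set SM) t N : 0 < t <= 1 -> cone01 A (t *: sv N) <-> A N.
Proof.
move=> t01; split; last exact: cone01_scale.
move=> [t' [N' [t01' [AN' e]]]]; have /andP[t0 _] := t01; have /andP[t0' _] := t01'.
by have [_ ->] := scale_sv_inj t0 t0' e.
Qed.

Lemma cone01T : cone01 [set: SM] = [set y | 0 < dot y y] `&` [set y | dot y y <= 1].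
Proof.
apply/seteqP; split => [y [t [N [/andP[t0 t1] [_ ->]]]]|y /= [y0 y1]].
  rewrite /= !(dotZl, dotZr) dot_sv !mulr1 -expr2.
  by rewrite exprn_gt0// exprn_ile1// ltW.
(* Polar decomposition: the square root of [dot y y] is the radius, and dividing by it gives the
   direction on the sphere. *)
have s0 : 0 < Num.sqrt (dot y y) by rewrite sqrtr_gt0.
have uS : sphere ((Num.sqrt (dot y y))^-1 *: y).
  rewrite /sphere/= !(dotZl, dotZr) mulrA -expr2 exprVn sqr_sqrtr ?ltW//.
  by rewrite mulVf ?gt_eqF.
exists (Num.sqrt (dot y y)), (exist (fun z : V => z \in @sphere R n) _ (mem_set uS));
  split; last split => //.
  by rewrite s0/= -sqrtr1 ler_sqrt.
by rewrite /sv set_valE /= scalerA mulfV ?gt_eqF// scale1r.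
Qed.

Lemma cone01_bigcup (F : (set SM)^nat) : cone01 (\bigcup_k F k) = \bigcup_k cone01 (F k).
Proof.
apply/seteqP; split => [y [t [N [t01 [[k _ FN] ->]]]]|y [k _ [t [N [t01 [FN ->]]]]]].
  by exists k => //; exact: cone01_scale.
by apply: cone01_scale => //; exists k.
Qed.

Lemma cone01C (A : set SM) : cone01 (~` A) = cone01 setT `\` cone01 A.
Proof.
apply/seteqP; split => [y [t [N [t01 [AN ->]]]]|y [[t [N [t01 [_ ->]]]]]].
  by split; [exact: cone01_scale|move/(cone01P _ _ t01)].
by move=> AN; apply: cone01_scale => // /(cone01_scale t01).
Qed.

Local Notation mL := ((@lebesgue_outer R n).-cara.-measurable).

Lemma cone01T_lebesgue_measurable : mL (cone01 setT).
Proof.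
rewrite cone01T; apply: measurableI.
  apply: open_lebesgue_measurable; apply: open_fun_gt.
  exact: continuous_dot_self.
apply: closed_lebesgue_measurable; apply: closed_fun_le;
  [exact: continuous_dot_self|exact: cst_continuous].
Qed.

(** Induction over the generated sigma-algebra: [cone01] commutes with countable unions and with
    complements relative to the punctured ball. The cone over a cap is cut out of that ball by the
    closed homogeneous condition that coordinate [i] is at most [c] times the norm. *)
Lemma cone01_lebesgue_measurable (A : set SM) : measurable A -> mL (cone01 A).
Proof.
rewrite measurable_SphE => mA.
apply: (smallest_sub (X := [set A | mL (cone01 A)]) _ _ mA);
  first split => [|B mB|F mF] /=.
- rewrite (_ : cone01 set0 = set0)// -subset0 => y [t [N [_ []]]] //.
- by rewrite setTD cone01C; apply: measurableD => //; exact: cone01T_lebesgue_measurable.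
- by rewrite cone01_bigcup; apply: bigcupT_measurable.
move=> _ [i [c ->]] /=.
rewrite (_ : cone01 _ = cone01 setT `&` [set y : V | y 0 i <= c * Num.sqrt (dot y y)]);
  last first.
  have E t N : 0 < t -> ((t *: sv N) 0 i <= c * Num.sqrt (dot (t *: sv N) (t *: sv N)))
      = (sv N 0 i <= c).
    move=> t0; rewrite !(dotZl, dotZr) dot_sv mulr1 -expr2 sqrtr_sqr gtr0_norm//.
    by rewrite mxE mulrC ler_pM2r.
  apply/seteqP; split => [y [t [N [t01 [/= AN ->]]]]|y [[t [N [t01 [_ ->]]]]]/=].
    split; first exact: cone01_scale.
    by rewrite /= E//; case/andP: t01.
  by rewrite E; [move=> AN; exact: cone01_scale|case/andP: t01].
apply: measurableI; first exact: cone01T_lebesgue_measurable.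
apply: closed_lebesgue_measurable; apply: closed_fun_le.
  exact: coord_continuous.
apply: continuous_mul => [|{}y]; first exact: cst_continuous.
by apply: continuous_comp; [exact: continuous_dot_self|exact: sqrt_continuous].
Qed.

Lemma sigma_set0 : sigma (set0 : set SM) = 0%E.
Proof.
rewrite /sigma (_ : cone01 set0 = set0) ?lebesgue_outer0 ?mule0//.
by rewrite -subset0 => y [t [N [_ []]]].
Qed.

Lemma sigma_ge0 (A : set SM) : (0 <= sigma A)%E.
Proof. by rewrite mule_ge0 ?lee_fin// lebesgue_outer_ge0. Qed.

(** Distinct points of the sphere span disjoint segments, so disjoint sets have disjoint cones, and
    additivity on Carathéodory-measurable sets carries over. *)
Lemma sigma_semi_sigma_additive : semi_sigma_additive (@sigma R n).
Proof.
move=> F mF tF mUF.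
have := @measure_semi_sigma_additive _ _ _ (@lebesgue_caratheodory R n)
  (fun k => cone01 (F k)) (fun k => cone01_lebesgue_measurable (mF k)).
rewrite -cone01_bigcup => cvgF.
have {}cvgF : (fun k => \sum_(0 <= i < k) lebesgue_outer (cone01 (F i)))%E @ \oo -->
    lebesgue_outer (cone01 (\bigcup_k F k)).
  apply: cvgF; last exact: cone01_lebesgue_measurable.
  apply/trivIsetP => i j _ _ ij; apply/seteqP; split => // y [[t [N [t01 [Fi ->]]]]].
  move/(cone01P _ _ t01) => Fj; move/trivIsetP : tF => /(_ i j I I ij).
  by move/seteqP => [/(_ N) + _]; exact.
have := cvgeZl (y := n.+1%:R%:E) isT cvgF.
rewrite /sigma; apply: cvg_trans; apply: near_eq_cvg; near=> k.
by rewrite ge0_sume_distrr// => *; exact: lebesgue_outer_ge0.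
Unshelve. all: by end_near. Qed.

HB.instance Definition _ := isMeasure.Build _ _ _ (@sigma R n)
  sigma_set0 sigma_ge0 sigma_semi_sigma_additive.

Lemma sigma_lty (A : set SM) : (sigma A < +oo)%E.
Proof.
rewrite /sigma lte_mul_pinfty ?lee_fin//.
apply: (@le_lt_trans _ _ (lebesgue_outer (box (const_mx (-1) : V) (const_mx 1)))).
  apply: le_lebesgue_outer => _ [t [N [/andP[t0 t1] [_ ->]]]] i.
  rewrite !mxE -ler_norml normrM gtr0_norm//.
  by rewrite -[leRHS]mulr1; apply: ler_pM => //; [exact: ltW|exact: sv_coord_le1].
by apply: box_lebesgue_lty => i; rewrite !mxE; lra.
Qed.

Lemma compact_Sph : compact [set: S].
Proof.
have cS : compact (@sphere R n).
  apply: bounded_closed_compact; last first.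
    apply: (@closed_fun_eq _ _ (fun x : V => dot x x) (cst 1));
      [exact: continuous_dot_self|exact: cst_continuous].
  exists 1; split => // M M1 x Sx; apply/ltW/(le_lt_trans _ M1).
  rewrite [leLHS]mx_normrE; apply: bigmax_le => //= -[k i] _ /=; rewrite (ord1 k).
  by have := dot_coord_le x i; rewrite [dot x x]Sx => h; apply/ler_normlP; split; nra.
(* Compactness passes from the subset of the ambient space to the subtype: the image filter clusters
   at some [x] on the sphere, and neighbourhoods in the subtype are traces of ambient ones. *)
move=> F FF _; have [|x [Sx Fx]] := cS (@sv R n @ F) _.
  by rewrite /fmap/=; apply: filterE => N; exact: set_mem (proj2_sig N).
exists (exist _ x (mem_set Sx)); split => // A B FA /=.
rewrite nbhsE => -[_ [[ O oO <-] Ox] OB].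
have [|y [[N AN Ny] Oy]] := Fx (@sv R n @` A) O _ (open_nbhs_nbhs (conj oO Ox)).
  by apply: (@filterS _ F _ A) => // N AN; exists N.
by exists N; split => //; apply: OB; rewrite /preimage/= -[set_val N]/(sv N) Ny.
Qed.

End SurfaceMeasure.

(** * Support functions and contact points *)

Section RadialSupport.
Context {R : realType} {n : nat}.
Local Notation V := 'rV[R]_(n.+1).
Local Notation S := (Sph R n).
Local Notation SM := (SphM R n).
Implicit Types (rho : S -> R) (A F : set S) (y z : V) (i : 'I_n.+1) (N : S).

(** The support function of the set of vectors [rho x *: sv x] with [x] in [A]. It is taken on all
    vectors, so that homogeneity and motion along an axis make sense; comparing a subset [A] with
    the whole sphere detects contact points in [A]. *)
Definition radial_support rho A y : R :=
  sup [set rho x * dot (sv x) y | x in A].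

Lemma closed_Sph_compact A : closed A -> compact A.
Proof. by move=> cA; apply: (subclosed_compact cA (@compact_Sph R n)). Qed.

Lemma continuous_dot_sv y : continuous (fun x : S => dot (sv x) y).
Proof.
apply: continuous_sumr => i; apply: continuous_mul; last exact: cst_continuous.
exact: continuous_sv_coord.
Qed.

Section Continuous.
Variable rho : S -> R.
Hypothesis crho : continuous rho.

Lemma radial_support_max A y : closed A -> A !=set0 ->
  exists2 x, A x & radial_support rho A y = rho x * dot (sv x) y /\
    forall x', A x' -> rho x' * dot (sv x') y <= radial_support rho A y.
Proof.
move=> cA A0.
have cf : continuous (fun x : S => rho x * dot (sv x) y).
  by apply: continuous_mul => //; exact: continuous_dot_sv.
have [x xA xmax] := compact_EVT_max A0 (closed_Sph_compact cA) (continuous_subspaceT cf).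
have e : radial_support rho A y = rho x * dot (sv x) y.
  apply/eqP; rewrite eq_le; apply/andP; split.
    apply: ge_sup; first by case: A0 => a Aa; exists (rho a * dot (sv a) y), a.
    by move=> _ [x' /mem_set/xmax le <-].
  apply: ub_le_sup; last by exists x => //; exact: set_mem.
  by exists (rho x * dot (sv x) y) => _ [x' /mem_set/xmax le <-].
by exists x; [exact: set_mem|split => // x' /mem_set/xmax; rewrite e].
Qed.

Lemma radial_support_ub A y x : closed A -> A x ->
  rho x * dot (sv x) y <= radial_support rho A y.
Proof.
by move=> cA Ax; have [|_ _ [_]] := radial_support_max y cA; [exists x|exact].
Qed.

Lemma radial_support_subset A A' y : closed A -> closed A' -> A !=set0 ->
  A `<=` A' -> radial_support rho A y <= radial_support rho A' y.
Proof.
move=> cA cA' A0 AA'; have [x Ax [-> _]] := radial_support_max y cA A0.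
by apply: radial_support_ub => //; exact: AA'.
Qed.

Lemma radial_supportZ A t y : closed A -> A !=set0 -> 0 < t ->
  radial_support rho A (t *: y) = t * radial_support rho A y.
Proof.
move=> cA A0 t0; apply/eqP; rewrite eq_le; apply/andP; split.
  have [x Ax [-> _]] := radial_support_max (t *: y) cA A0.
  by rewrite dotZr mulrCA ler_pM2l//; exact: radial_support_ub.
have [x Ax [-> _]] := radial_support_max y cA A0.
by rewrite mulrCA -dotZr; exact: radial_support_ub.
Qed.

(** The function is Lipschitz for the sum of coordinate differences, with constant the maximum of
    [rho] in absolute value, since coordinates of unit vectors are at most 1. *)
Lemma radial_support_continuous A : closed A -> A !=set0 ->
  continuous (radial_support rho A).
Proof.
move=> cA A0.
have [m _ mmax] : exists2 m, m \in [set: S] & forall x, x \in [set: S] -> `|rho x| <= `|rho m|.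
  apply: (@compact_EVT_max _ _ (fun x => `|rho x|)).
  - by case: A0 => a _; exists a.
  - exact: compact_Sph.
  - exact: continuous_subspaceT (continuous_norm crho).
pose d y z : R := `|rho m| * \sum_i `|z 0 i - y 0 i|.
have half y z : radial_support rho A y - radial_support rho A z <= d y z.
  have [x Ax [-> _]] := radial_support_max y cA A0.
  have le := radial_support_ub z cA Ax.
  apply: (@le_trans _ _ (rho x * (dot (sv x) y - dot (sv x) z))); first lra.
  apply: (le_trans (ler_norm _)); rewrite normrM; apply: ler_pM => //.
    by apply: mmax; rewrite inE.
  rewrite /dot -sumrB; apply: (le_trans (ler_norm_sum _ _ _)); apply: ler_sum => i _.
  rewrite -mulrBr normrM distrC -[leRHS]mul1r; apply: ler_pM => //; exact: sv_coord_le1.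
have dC y z : d y z = d z y.
  by congr (_ * _); apply: eq_bigr => i _; rewrite distrC.
apply: (@continuous_dominated _ _ _ d) => [y|y|y z].
- apply: continuous_mul; first exact: cst_continuous.
  apply: continuous_sumr => i; apply: continuous_norm.
  by apply: continuous_sub; [exact: coord_continuous|exact: cst_continuous].
- by rewrite /d big1 ?mulr0// => i _; rewrite subrr normr0.
- by rewrite ler_norml half andbT lerNl opprB dC half.
Qed.

Lemma radial_support_sv_continuous A : closed A -> A !=set0 ->
  continuous (fun N => radial_support rho A (sv N)).
Proof.
move=> cA A0 N; apply: (@continuous_comp _ _ _ (@sv R n) (radial_support rho A)).
  exact: sv_continuous.
exact: radial_support_continuous.
Qed.

Lemma Sph_setT_neq0 : [set: S] !=set0.
Proof. by exists point. Qed.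

Lemma continuous_support_function :
  continuous (fun N => radial_support rho setT (sv N)).
Proof.
by apply: radial_support_sv_continuous; [exact: closedT|exact: Sph_setT_neq0].
Qed.

Lemma radial_support_gt0 N : (forall x, 0 < rho x) ->
  0 < radial_support rho setT (sv N).
Proof.
move=> r0; apply: lt_le_trans (radial_support_ub (sv N) closedT (x := N) I).
by rewrite dot_sv mulr1.
Qed.

Definition contact x N := rho x * dot (sv x) (sv N) = radial_support rho setT (sv N).

Lemma contact_exists N : exists x, contact x N.
Proof.
by have [x _ [e _]] := radial_support_max (sv N) closedT Sph_setT_neq0; exists x.
Qed.

(** The unit normals of the hyperplanes that support the convex hull of the vectors [rho x *: sv x]
    and touch it at a vector with [x] in [F]. *)
Definition contact_image F : set S := [set N | exists2 x, F x & contact x N].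

(** Since the supremum over [F] is attained, the existence of a contact point in [F] becomes an
    equality of two continuous functions of the normal, a closed condition. *)
Lemma contact_imageE F : closed F -> F !=set0 -> contact_image F =
  [set N | radial_support rho F (sv N) = radial_support rho setT (sv N)].
Proof.
move=> cF F0; apply/seteqP; split => [N [x Fx xN]|N /= e].
  apply/eqP; rewrite eq_le radial_support_subset ?closedT//= -xN.
  exact: radial_support_ub.
by have [x Fx [xe _]] := radial_support_max (sv N) cF F0; exists x;
  rewrite ///contact -xe.
Qed.

Lemma closed_contact_image F : closed F -> closed (contact_image F).
Proof.
move=> cF; have [->|/set0P F0] := eqVneq F set0.
  rewrite (_ : contact_image set0 = set0); first exact: closed0.
  by rewrite -subset0 => N [x []].
rewrite contact_imageE//; apply: closed_fun_eq; apply: radial_support_sv_continuous => //;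
  first [exact: closedT|exact: Sph_setT_neq0].
Qed.

(** * Normals with several contact points *)

Definition coord_le i (q : R) : set S := [set x | rho x * sv x 0 i <= q].
Definition coord_ge i (r : R) : set S := [set x | r <= rho x * sv x 0 i].

Lemma continuous_radial_coord i : continuous (fun x => rho x * sv x 0 i).
Proof.
by apply: continuous_mul => //; exact: continuous_sv_coord.
Qed.

Lemma closed_coord_le i q : closed (coord_le i q).
Proof. by apply: closed_fun_le;
  [exact: continuous_radial_coord|exact: cst_continuous]. Qed.

Lemma closed_coord_ge i r : closed (coord_ge i r).
Proof. by apply: closed_fun_le;
  [exact: cst_continuous|exact: continuous_radial_coord]. Qed.

Definition split_normals i q r : set S :=
  contact_image (coord_le i q) `&` contact_image (coord_ge i r).

(** The cone over these normals lies in a closed part [G] of a cube, where the two partial support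
    functions both agree with the full one. By monotonicity of subgradients, [G] meets every line
    parallel to axis [i] at most once, so it is null. *)
Lemma split_normals_null i q r : q < r -> sigma (split_normals i q r : set SM) = 0%E.
Proof.
move=> qr; have [->|/set0P[N0 [[x1 x1A _] [x2 x2A _]]]] := eqVneq (split_normals i q r) set0.
  exact: measure0.
have A10 : coord_le i q !=set0 by exists x1.
have A20 : coord_ge i r !=set0 by exists x2.
have cA1 := @closed_coord_le i q; have cA2 := @closed_coord_ge i r.
pose H := radial_support rho setT.
pose G : set V := [set y : V | (forall j, y 0 j <= 1) /\ (forall j, -1 <= y 0 j)] `&`
  ([set y : V | radial_support rho (coord_le i q) y = H y] `&`
   [set y : V | radial_support rho (coord_ge i r) y = H y]).
have cG : closed G.
  apply: closedI; last first.
    by apply: closedI; apply: closed_fun_eq;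
      apply: radial_support_continuous => //; first [exact: closedT|exact: Sph_setT_neq0].
  rewrite (_ : mkset _ = (\bigcap_j [set y : V | y 0 j <= 1]) `&`
      (\bigcap_j [set y : V | -1 <= y 0 j])).
    by apply: closedI; apply: closed_bigI => j _; apply: closed_fun_le;
      first [exact: cst_continuous|exact: coord_continuous].
  by apply/seteqP; split => y [y1 y2]; split => j; [move=> _; exact: y1|move=> _;
    exact: y2|exact: y1|exact: y2].
rewrite /sigma (_ : lebesgue_outer _ = 0)%E ?mule0//.
apply/eqP; rewrite eq_le lebesgue_outer_ge0 andbT.
rewrite -(@lebesgue_outer_thin _ _ i G cG); last 2 first.
- by move=> y [[y1 y2] _] j; rewrite !mxE y1 y2.
- move=> y s s0 [_ [_ ey]] [_ [ez _]].
  (* Take [p2] supporting at [y] with coordinate at least [r], and [p1] supporting at the shifted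
     point with coordinate at most [q]. Adding the two support inequalities gives [s * b <= s * a],
     against [a <= q < r <= b]. *)
  have [p2 p2A [e2 _]] := radial_support_max y cA2 A20.
  have [p1 p1A [e1 _]] := radial_support_max (y + s *: delta_mx 0 i) cA1 A10.
  have := radial_support_ub (y + s *: delta_mx 0 i) closedT (x := p2) I.
  have := radial_support_ub y closedT (x := p1) I.
  rewrite -/H -ez -ey e1 e2 !dotDr !dotZr !dot_delta.
  move: p1A p2A; rewrite /coord_le /coord_ge /=.
  set a := rho p1 * sv p1 0 i; set b := rho p2 * sv p2 0 i => aq rb le1 le2.
  have ab : s * b <= s * a.
    by rewrite /a /b; nra.
  move: ab; rewrite ler_pM2l// => ab; lra.
apply: le_lebesgue_outer => _ [t [N [/andP[t0 t1] [[N1 N2] ->]]]].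
split.
  have b j : `|(t *: sv N) 0 j| <= 1.
    rewrite mxE normrM gtr0_norm// -[leRHS]mulr1.
    by apply: ler_pM => //; [exact: ltW|exact: sv_coord_le1].
  by split => j; have := b j; rewrite ler_norml => /andP[].
move: N1 N2; rewrite !contact_imageE//= => N1 N2.
by split; rewrite /= /H !radial_supportZ ?N1 ?N2//;
  first [exact: closedT|exact: Sph_setT_neq0].
Qed.

(** A countable union over codes of triples of an axis and two rationals; codes of no triple, or of
    one with the rationals out of order, contribute the empty set. *)
Definition nonunique : set S := \bigcup_k
  (if (unpickle k : option ('I_n.+1 * rat * rat)) is Some (i, q, r) then
     if q < r then split_normals i (ratr q) (ratr r) else set0
   else set0 : set S).

Lemma measurable_split_normals i q r : measurable (split_normals i q r : set SM).
Proof.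
apply: measurableI; apply: measurable_closed_Sph; apply: closed_contact_image.
  exact: closed_coord_le.
exact: closed_coord_ge.
Qed.

Lemma measurable_nonunique : measurable (nonunique : set SM).
Proof.
apply: bigcupT_measurable => k; case: unpickle => [[[i q] r]|//].
by case: ifP => // _; exact: measurable_split_normals.
Qed.

Lemma sigma_nonunique : sigma (nonunique : set SM) = 0%E.
Proof.
apply/(@negligibleP _ _ _ (@sigma R n)); first exact: measurable_nonunique.
apply: negligible_bigcup => k; apply/negligibleP.
  case: unpickle => [[[i q] r]|//].
  by case: ifP => // _; exact: measurable_split_normals.
case: unpickle => [[[i q] r]|]; last exact: measure0.
case: ifP => [qr|_]; last exact: measure0.
by apply: split_normals_null; rewrite ltr_rat.
Qed.

(** If the vectors [rho x *: sv x] and [rho x' *: sv x'] differed in a coordinate, two rationals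
    would fit between the values and put [N] in [nonunique]. Equal vectors have equal directions. *)
Lemma contact_unique x x' N : (forall x, 0 < rho x) -> ~ nonunique N ->
  contact x N -> contact x' N -> x = x'.
Proof.
move=> r0 nN xN x'N.
have H i (u v : S) : contact u N -> contact v N -> ~ (rho u * sv u 0 i < rho v * sv v 0 i).
  move=> uN vN /rat_in_itvoo[q]; rewrite in_itv/= => /andP[uq /rat_in_itvoo[r]].
  rewrite in_itv/= => /andP[qr rv]; apply: nN.
  exists (pickle (i, q, r)) => //; rewrite pickleK; move: (qr); rewrite ltr_rat => ->.
  by split; [exists u => //; exact: ltW|exists v => //; exact: ltW].
have e : rho x *: sv x = rho x' *: sv x'.
  apply/rowP => i; rewrite !mxE; apply/eqP; rewrite eq_le !leNgt.
  by apply/andP; split; apply/negP; exact: H.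
by have [] := scale_sv_inj (r0 x) (r0 x') e.
Qed.

(* The constant value on the null set [nonunique] makes the map measurable. *)
Definition normal_to_point N : S :=
  if N \in nonunique then point else xget point [set x | contact x N].

Lemma normal_to_point_contact N : ~ nonunique N -> contact (normal_to_point N) N.
Proof.
move=> nN; rewrite /normal_to_point memNset//.
by case: xgetP => [x -> //|no]; have [x xN] := contact_exists N; case: (no x).
Qed.

Lemma preimage_normal_to_point F : (forall x, 0 < rho x) ->
  normal_to_point @^-1` F `\` nonunique = contact_image F `\` nonunique.
Proof.
move=> r0; apply/seteqP; split => N [FN nN]; split => //.
  by exists (normal_to_point N) => //; exact: normal_to_point_contact.
have [x Fx xN] := FN; rewrite /preimage/=.
by rewrite (contact_unique r0 nN (normal_to_point_contact nN) xN).
Qed.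

(** Off [nonunique], the preimage of a closed set is its closed contact image; on [nonunique] the
    map is constant, so that part is everything or nothing. *)
Lemma measurable_normal_to_point : (forall x, 0 < rho x) ->
  measurable_fun setT (normal_to_point : SM -> SM).
Proof.
move=> r0; pose T : SM -> SM := normal_to_point.
suff mC F : closed F -> measurable (T @^-1` F).
  apply: (@measurability _ _ _ _ setT T (@open S)) => // _ [ O oO <-].
  by rewrite setTI; have := measurableC (mC _ (open_closedC oO));
    rewrite preimage_setC setCK.
move=> cF; rewrite -(setUIDK (T @^-1` F) nonunique).
apply: measurableU; last first.
  rewrite (preimage_normal_to_point _ r0).
  apply: measurableD; last exact: measurable_nonunique.
  by apply: measurable_closed_Sph; exact: closed_contact_image.
have [pF|pF] := pselect (F point).
  rewrite (_ : _ `&` _ = nonunique); first exact: measurable_nonunique.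
  apply/seteqP; split => [N []//|N nN]; split => //.
  by rewrite /preimage/= /T /normal_to_point mem_set.
rewrite (_ : _ `&` _ = set0)// -subset0 => N [/= + nN].
by rewrite /T /normal_to_point mem_set.
Qed.

End Continuous.
End RadialSupport.

(** * Bounded functions under finite measures and change of variables *)

Section FiniteMeasure.
Context {d} {T : measurableType d} {R : realType}.
Variable m : {measure set T -> \bar R}.
Hypothesis mfin : (m setT < +oo)%E.

Definition mbounded (f : T -> R) :=
  measurable_fun setT f /\ exists M, forall x, `|f x| <= M.

Lemma mbounded_integrable f : mbounded f -> m.-integrable setT (EFin \o f).
Proof.
move=> [mf [M fM]]; apply: measurable_bounded_integrable => //.
exists M; split; first exact: num_real.
by move=> N MN x _; exact: le_trans (fM x) (ltW MN).
Qed.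

Lemma integrable_scaled_indic t A : measurable A ->
  m.-integrable setT (fun x => t%:E * (\1_A x)%:E)%E.
Proof.
move=> mA; apply: (integrableZl measurableT t).
apply: (@mbounded_integrable (\1_A)); split; first exact: measurable_indic.
by exists 1 => x; rewrite indicE normr_nat lern1; case: (_ \in _).
Qed.

Lemma integral_scaled_indic t A : measurable A ->
  (\int[m]_x (t%:E * (\1_A x)%:E) = t%:E * m A)%E.
Proof.
move=> mA; rewrite integralZl//; first by rewrite integral_indic// setIT.
by have := integrable_scaled_indic 1 mA; apply: eq_integrable => // x _; rewrite mul1e.
Qed.

End FiniteMeasure.

Lemma mbounded_comp {R : realType} d d' (T : measurableType d)
    (T' : measurableType d') (f : T -> R) (phi : T' -> T) :
  measurable_fun setT phi -> mbounded f -> mbounded (f \o phi).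
Proof.
move=> mphi [mf [M fM]]; split; first exact: measurableT_comp.
by exists M => x; exact: fM.
Qed.

(** Change of variables in the form used for couplings, where [phi] is a coordinate projection and
    [m2] the corresponding marginal. *)
Lemma integral_marginal {R : realType} d1 d2 (T1 : measurableType d1)
    (T2 : measurableType d2) (phi : T1 -> T2)
    (m1 : {measure set T1 -> \bar R}) (m2 : {measure set T2 -> \bar R}) f :
  measurable_fun setT phi -> (m1 setT < +oo)%E -> mbounded f ->
  (forall A, measurable A -> m1 (phi @^-1` A) = m2 A) ->
  (\int[m1]_x (f (phi x))%:E = \int[m2]_x (f x)%:E)%E.
Proof.
move=> mphi m1fin bf m12.
have := @integral_pushforward _ _ _ _ R phi mphi m1 setT (EFin \o f).
rewrite preimage_setT => <-//; last 2 first.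
- by apply/measurable_EFinP; case: bf.
- exact: (mbounded_integrable m1fin (mbounded_comp mphi bf)).
by apply: eq_measure_integral => A mA _; rewrite /= /pushforward m12.
Qed.

Section SphIntegrals.
Context {R : realType} {n : nat}.
Local Notation S := (Sph R n).
Local Notation SM := (SphM R n).

Lemma continuous_mbounded (f : S -> R) : continuous f -> mbounded (f : SM -> R).
Proof.
move=> cf; split.
  apply: (measurability _ (RGenOInfty.measurableE R)).
  move=> _ [_ [y ->] <-]; rewrite setTI; apply: measurable_open_Sph.
  rewrite (_ : _ @^-1` _ = [set N | y < f N]); first exact: open_fun_gt.
  by apply/seteqP; split => N /=; rewrite in_itv/= andbT.
have [m _ mmax] : exists2 m, m \in [set: S] & forall x, x \in [set: S] -> `|f x| <= `|f m|.
  apply: (@compact_EVT_max _ _ (fun x => `|f x|)).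
  - exact: Sph_setT_neq0.
  - exact: compact_Sph.
  - exact: continuous_subspaceT (continuous_norm cf).
by exists `|f m| => x; apply: mmax; rewrite inE.
Qed.

Lemma admissible_radial_support (rho : S -> R) : continuous rho ->
  (forall x, 0 < rho x) ->
  admissible (fun N => radial_support rho setT (sv N)) rho.
Proof.
move=> crho r0; split; last split => //; last split; last split => //.
- exact: continuous_support_function.
- by move=> N; exact: radial_support_gt0.
- move=> x N xN; rewrite lerBrDl -lnM ?posrE// ler_ln ?posrE ?mulr_gt0//.
    exact: (radial_support_ub crho _ closedT).
  exact: radial_support_gt0.
Qed.

Local Notation sublevel f := [set x | (f x <= 0)%R].

(** * The first variation and the transport of [sigma] *)

Section Variation.
Variables (mu : {measure set SM -> \bar R}) (rho : S -> R).
Hypotheses (mufin : (mu setT < +oo)%E) (crho : continuous rho)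
  (rho0 : forall x, 0 < rho x).
Let h N := radial_support rho setT (sv N).
Hypothesis hmin : forall h' rho', admissible h' rho' ->
  (Qfun mu h rho <= Qfun mu h' rho')%E.

Let h0 N : 0 < h N. Proof. exact: radial_support_gt0. Qed.

(** Contact up to a factor [expR t], at a point where [f] is at most [t]. Only at such normals can
    multiplying [rho] by a factor between 1 and [expR t], equal to 1 where [f] is at least [t],
    raise the support function. *)
Definition near_contact (f : S -> R) (t : R) : set S :=
  [set N | exists2 x, f x <= t & h N <= expR t * (rho x * dot (sv x) (sv N))].

Lemma closed_near_contact (f : S -> R) t : continuous f -> closed (near_contact f t).
Proof.
move=> cf; pose F := [set x | f x <= t].
have cF : closed F by apply: closed_fun_le => //; exact: cst_continuous.
have [F0|/set0P F0] := eqVneq F set0.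
  rewrite (_ : near_contact f t = set0); first exact: closed0.
  by rewrite -subset0 => N [x xt _]; have : F x := xt; rewrite F0.
rewrite (_ : near_contact f t = [set N | h N <= expR t * radial_support rho F (sv N)]).
  apply: closed_fun_le; last apply: continuous_mul; first last.
  - exact: radial_support_sv_continuous.
  - exact: cst_continuous.
  - exact: continuous_support_function.
apply/seteqP; split => N /= => [[x xt le]|le].
  by apply: (le_trans le); rewrite ler_pM2l ?expR_gt0//; exact: radial_support_ub.
by have [x Fx [xe _]] := radial_support_max crho (sv N) cF F0; exists x; rewrite // -xe.
Qed.

Lemma near_contact_le (f : S -> R) s t : s <= t -> near_contact f s `<=` near_contact f t.
Proof.
move=> st N [x xs le]; exists x; first exact: le_trans xs st.
apply: (le_trans le); apply: ler_wpM2r; last by rewrite ler_expR.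
by have := lt_le_trans (h0 N) le; rewrite pmulr_rgt0 ?expR_gt0// => /ltW.
Qed.

Lemma near_contact_cap (f : S -> R) : continuous f ->
  \bigcap_k near_contact f k.+1%:R^-1 `<=` contact_image rho (sublevel f).
Proof.
move=> cf N Nk.
(* A minimizer of [psi] lies in the sublevel set and is a contact point. *)
pose psi x := Num.max (f x) (h N - rho x * dot (sv x) (sv N)).
have cpsi : continuous psi.
  apply: continuous_maxr => //; apply: continuous_sub; first exact: cst_continuous.
  by apply: continuous_mul => //; exact: continuous_dot_sv.
have [x _ xmin] := compact_EVT_min Sph_setT_neq0 (@compact_Sph R n) (continuous_subspaceT cpsi).
have psi0 : psi x <= 0.
  apply/ler_addgt0Pr => e e0; rewrite add0r.
  (* With [t] the inverse of [k.+1], both entries of [psi y] are at most [C * t]: the first is at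
     most [t], the second at most [h N * (1 - expR (- t))], hence at most [h N * t]. The index [k]
     makes this at most [e]. *)
  pose C := Num.max 1 (h N); have C0 : 0 < C by rewrite lt_max ltr01.
  pose k := Num.bound (C / e).
  have Cke : C * k.+1%:R^-1 <= e.
    rewrite ler_pdivrMr ?ltr0n// mulrC -ler_pdivrMr//.
    by rewrite (le_trans (ltW (archi_boundP (divr_ge0 (ltW C0) (ltW e0)))))// ler_nat.
  have [y yt le] := Nk k I.
  apply: le_trans (xmin y _) _; first by rewrite inE.
  set t := k.+1%:R^-1 in Cke yt le; have t0 : 0 < t by rewrite invr_gt0 ltr0n.
  rewrite /psi ge_max; apply/andP; split.
    apply: (le_trans yt); apply: le_trans Cke.
    by rewrite -[leLHS]mul1r ler_pM2r// le_max lexx.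
  apply: le_trans Cke; apply: (@le_trans _ _ (h N * t)); last first.
    by rewrite ler_pM2r// le_max lexx orbT.
  have := expR_ge1Dx (- t); have := le.
  rewrite -ler_pdivrMl ?expR_gt0// -expRN => le1 le2; have := h0 N; nra.
move: psi0; rewrite /psi ge_max => /andP[fx hx]; exists x => //.
apply/eqP; rewrite eq_le -[X in _ && X]subr_le0 hx andbT.
exact: (radial_support_ub crho _ closedT).
Qed.

(** A first variation at a fixed step [t]. Replacing [rho] by [rho * expR (t * phi)] raises the
    [sigma]-integral by at most [t] times the mass of the near contacts and the [mu]-integral by at
    least [t] times the mass of the sublevel set; minimality compares the two. *)
Lemma near_contact_mass (f : S -> R) t : continuous f -> 0 < t ->
  (mu (sublevel f) <= sigma (near_contact f t : set SM))%E.
Proof.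
move=> cf t0.
have mD : measurable (near_contact f t : set SM).
  by apply: measurable_closed_Sph; exact: closed_near_contact.
have mF : measurable (sublevel f : set SM).
  by apply: measurable_closed_Sph; apply: closed_fun_le => //; exact: cst_continuous.
(* A continuous cutoff, equal to 1 where [f] is nonpositive and to 0 where [f] is at least [t]. *)
pose phi x := Num.min 1 (Num.max 0 (1 - f x / t)).
have cphi : continuous phi.
  apply: continuous_minr; first exact: cst_continuous.
  apply: continuous_maxr; first exact: cst_continuous.
  apply: continuous_sub; first exact: cst_continuous.
  by apply: continuous_mul => //; exact: cst_continuous.
have phi1 x : phi x <= 1 by rewrite ge_min lexx.
have phi_ge0 x : 0 <= phi x by rewrite le_min ler01/= le_max lexx.
have phiF x : f x <= 0 -> phi x = 1.
  move=> fx; apply/min_idPl; rewrite le_max; apply/orP; right.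
  by rewrite lerBrDr gerDl pmulr_lle0// invr_gt0.
have phi0 x : t <= f x -> phi x = 0.
  move=> fx; rewrite /phi (max_idPl _) ?(min_idPr _)//.
  by rewrite subr_le0 ler_pdivlMr// mul1r.
pose rho' x := rho x * expR (t * phi x).
have crho' : continuous rho'.
  apply: continuous_mul => //; apply: continuous_expR_comp.
  by apply: continuous_mul => //; exact: cst_continuous.
have rho'0 x : 0 < rho' x by rewrite mulr_gt0// expR_gt0.
pose h' N := radial_support rho' setT (sv N).
have h'0 N : 0 < h' N by exact: radial_support_gt0.
have adm : admissible h' rho' by exact: admissible_radial_support.
have := hmin adm.
have ch : continuous h.
  exact: continuous_support_function.
have ch' : continuous h'.
  exact: continuous_support_function.
have sfin : (@sigma R n setT < +oo)%E by exact: sigma_lty.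
have ih := mbounded_integrable sfin (continuous_mbounded (continuous_ln_comp ch h0)).
have ih' := mbounded_integrable sfin (continuous_mbounded (continuous_ln_comp ch' h'0)).
have ir := mbounded_integrable mufin (continuous_mbounded (continuous_ln_comp crho rho0)).
have ir' := mbounded_integrable mufin (continuous_mbounded (continuous_ln_comp crho' rho'0)).
have iD := integrable_scaled_indic sfin t mD.
have iF := integrable_scaled_indic mufin t mF.
have le_h : (\int[@sigma R n]_(N in [set: SM]) (ln (h' N))%:E <=
    \int[@sigma R n]_(N in [set: SM]) (ln (h N))%:E + t%:E * sigma (near_contact f t : set SM))%E.
  rewrite -(integral_scaled_indic sfin t mD) -integralD//; apply: le_integral => //;
    first exact: integrableD.
  move=> N _ /=; rewrite lee_fin.
  have [x _ [h'E _]] := radial_support_max crho' (sv N) closedT Sph_setT_neq0.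
  have d0 : 0 < dot (sv x) (sv N) by have := h'0 N; rewrite /h' h'E pmulr_rgt0.
  have hx : rho x * dot (sv x) (sv N) <= h N by exact: (radial_support_ub crho _ closedT).
  have E : h' N = expR (t * phi x) * (rho x * dot (sv x) (sv N)).
    by rewrite /h' h'E /rho'; ring.
  have p0 : 0 < rho x * dot (sv x) (sv N) by rewrite mulr_gt0.
  have [ND|ND] := pselect (near_contact f t N).
    rewrite indicE mem_set// mulr1 -[X in _ <= _ + X]expRK -lnM ?posrE ?expR_gt0//.
    rewrite ler_ln ?posrE ?mulr_gt0 ?expR_gt0// mulrC E.
    apply: ler_pM => //; first exact: ltW.
    by rewrite ler_expR ler_piMr// ltW.
  rewrite indicE memNset// mulr0 addr0 ler_ln ?posrE// E.
  (* At a normal that is not a near contact, the maximiser [x] for [h'] either lies where [phi]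
     vanishes, or has [f x < t] and misses contact by more than the factor [expR t]; both give
     [h' N <= h N]. *)
  have [tf|ft] := leP t (f x); first by rewrite phi0// mulr0 expR0 mul1r.
  have : expR t * (rho x * dot (sv x) (sv N)) < h N.
    by rewrite ltNge; apply/negP => le; apply: ND; exists x => //; exact: ltW.
  move=> /ltW; apply: le_trans; rewrite ler_pM2r// ler_expR ler_piMr//; exact: ltW.
have le_r : (\int[mu]_(x in [set: SM]) (ln (rho x))%:E + t%:E * mu (sublevel f) <=
    \int[mu]_(x in [set: SM]) (ln (rho' x))%:E)%E.
  rewrite -(integral_scaled_indic mufin t mF) -integralD//; apply: le_integral => //;
    first exact: integrableD.
  move=> x _ /=; rewrite lee_fin /rho' lnM ?posrE ?expR_gt0// expRK lerD2l.
  rewrite ler_pM2l// indicE; have [fx|fx] := leP (f x) 0.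
    by rewrite phiF// mem_set.
  by rewrite memNset// => /=; rewrite leNgt fx.
have muF : mu (sublevel f) \is a fin_num.
  rewrite ge0_fin_numE//; apply: le_lt_trans mufin; apply: le_measure; rewrite ?inE//.
have sD : sigma (near_contact f t : set SM) \is a fin_num.
  by rewrite ge0_fin_numE ?sigma_ge0// sigma_lty.
move: (integrable_fin_num measurableT ih) (integrable_fin_num measurableT ih')
  (integrable_fin_num measurableT ir) (integrable_fin_num measurableT ir') le_h le_r.
rewrite /Qfun /= -(fineK muF) -(fineK sD) => /fineK <- /fineK <- /fineK <- /fineK <-.
move: (fine _) (fine _) (fine _) (fine _) (fine _) (fine _) => a b c d e g.
rewrite -!EFinM -!EFinD !lee_fin => H1 H2 H3.
have : t * b <= t * d by lra.
by rewrite ler_pM2l.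
Qed.

(** The step tends to 0 along inverses of integers: the near contacts decrease, [sigma] is finite
    and so continuous from above, and their intersection consists of true contacts. *)
Lemma contact_mass (f : S -> R) : continuous f ->
  (mu (sublevel f) <= sigma (contact_image rho (sublevel f) : set SM))%E.
Proof.
move=> cf; pose D k : set SM := near_contact f k.+1%:R^-1.
have mD k : measurable (D k).
  by apply: measurable_closed_Sph; exact: closed_near_contact.
have mDcap : measurable (\bigcap_k D k) by exact: bigcapT_measurable.
have cvgD : @sigma R n (D k) @[k --> \oo] --> @sigma R n (\bigcap_k D k).
  apply: nonincreasing_cvg_mu => //; first exact: sigma_lty.
  move=> j k jk; apply/subsetPset; apply: near_contact_le.
  by rewrite lef_pV2 ?posrE ?ltr0n// ler_nat.
apply: (@le_trans _ _ (sigma (\bigcap_k D k))).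
  apply: cvge_ge cvgD; apply: nearW => k.
  by apply: near_contact_mass => //; rewrite invr_gt0 ltr0n.
apply: (le_measure (@sigma R n)); rewrite ?inE//; last exact: near_contact_cap.
apply: measurable_closed_Sph; apply: closed_contact_image => //.
by apply: closed_fun_le => //; exact: cst_continuous.
Qed.

Hypothesis mu_tot : mu setT = sigma (setT : set SM).
Local Notation T := (normal_to_point rho : SM -> SM).

Lemma sublevel_mass_le (f : S -> R) : continuous f ->
  (mu (sublevel f) <= sigma (T @^-1` (sublevel f)))%E.
Proof.
move=> cf; apply: (le_trans (contact_mass cf)).
set F := sublevel f.
have mF : measurable (F : set SM).
  by apply: measurable_closed_Sph; apply: closed_fun_le => //; exact: cst_continuous.
have mTF : measurable (T @^-1` F).
  by rewrite -[X in measurable X]setTI; exact: measurable_normal_to_point.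
have mK : measurable (contact_image rho F : set SM).
  by apply: measurable_closed_Sph; apply: closed_contact_image => //;
    apply: closed_fun_le => //; exact: cst_continuous.
have mN := measurable_nonunique crho.
rewrite (measureDI (@sigma R n) mK mN) -(preimage_normal_to_point crho _ rho0).
rewrite [X in (_ + X)%E](_ : _ = 0)%E ?adde0.
  by apply: (le_measure (@sigma R n)); rewrite ?inE//; exact: measurableD.
apply/eqP; rewrite eq_le measure_ge0 andbT -(sigma_nonunique crho).
by apply: (le_measure (@sigma R n)); rewrite ?inE//; exact: measurableI.
Qed.

(** The complement of a sublevel set is an increasing union of sublevel sets, so the known
    inequality holds for it too. As the total masses agree, both inequalities are equalities. *)
Lemma sublevel_mass (f : S -> R) : continuous f ->
  mu (sublevel f) = sigma (T @^-1` (sublevel f)).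
Proof.
move=> cf; apply/eqP; rewrite eq_le sublevel_mass_le//=.
set F := sublevel f.
have mT A : measurable (A : set SM) -> measurable (T @^-1` A).
  by move=> mA; rewrite -[X in measurable X]setTI; exact: measurable_normal_to_point.
have mF : measurable (F : set SM).
  by apply: measurable_closed_Sph; apply: closed_fun_le => //; exact: cst_continuous.
pose O (k : nat) : set SM := [set x | k.+1%:R^-1 - f x <= 0].
have cO k : continuous (fun x => k.+1%:R^-1 - f x).
  by apply: continuous_sub => //; exact: cst_continuous.
have mO k : measurable (O k).
  by apply: measurable_closed_Sph; apply: closed_fun_le => //; exact: cst_continuous.
have OF : \bigcup_k O k = ~` F.
  apply/seteqP; split => [x [k _]|x /negP] /=.
    rewrite /O/= subr_le0 => kf; apply/negP; rewrite -ltNge.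
    by apply: lt_le_trans kf; rewrite invr_gt0 ltr0n.
  rewrite -ltNge => fx; exists (Num.bound (f x)^-1) => //=.
  rewrite /O/= subr_le0 -[leRHS]invrK lef_pV2 ?posrE ?ltr0n ?invr_gt0//.
  rewrite (le_trans (ltW (archi_boundP _)))// ?ler_nat// invr_ge0; exact: ltW.
have nd : nondecreasing_seq O.
  move=> j k jk; apply/subsetPset => x; rewrite /O/= !subr_le0; apply: le_trans.
  by rewrite lef_pV2 ?posrE ?ltr0n// ler_nat.
have c1 : mu (O k) @[k --> \oo] --> mu (~` F).
  rewrite -OF; apply: nondecreasing_cvg_mu => //; exact: bigcupT_measurable.
have c2 : @sigma R n (T @^-1` O k) @[k --> \oo] --> @sigma R n (T @^-1` (~` F)).
  rewrite -OF preimage_bigcup; apply: (@nondecreasing_cvg_mu _ _ _ (@sigma R n)).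
  - by move=> k; exact: mT.
  - by apply: bigcupT_measurable => k; exact: mT.
  - by move=> j k /nd/subsetPset jk; apply/subsetPset => x; exact: jk.
have le : (mu (~` F) <= sigma (T @^-1` (~` F)))%E.
  by apply: lee_cvg_to c1 c2 _; apply: nearW => k; exact: sublevel_mass_le.
have muT : mu setT = (mu F + mu (~` F))%E.
  rewrite -(setvU F) setUC measureU//; [exact: measurableC|by rewrite setICr].
have sT : sigma (setT : set SM) = (sigma (T @^-1` F) + sigma (T @^-1` (~` F)))%E.
  rewrite -(setvU (T @^-1` F)) setUC (measureU (@sigma R n))//.
  - exact: mT.
  - by apply: measurableC; exact: mT.
  - by rewrite setICr.
have f1 : mu F \is a fin_num.
  by rewrite ge0_fin_numE//; apply: le_lt_trans mufin; apply: le_measure; rewrite ?inE.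
have f2 : mu (~` F) \is a fin_num.
  rewrite ge0_fin_numE//; apply: le_lt_trans mufin; apply: le_measure; rewrite ?inE//.
  exact: measurableC.
have f3 : sigma (T @^-1` F) \is a fin_num by rewrite ge0_fin_numE ?sigma_ge0// sigma_lty.
have f4 : sigma (T @^-1` (~` F)) \is a fin_num by rewrite ge0_fin_numE ?sigma_ge0// sigma_lty.
move: mu_tot le; rewrite muT sT -(fineK f1) -(fineK f2) -(fineK f3) -(fineK f4).
by rewrite -!EFinD !lee_fin => -[]; lra.
Qed.

(** Sublevel sets of continuous functions are stable under intersection, by taking maxima, and
    generate the Borel sets, as they include the coordinate caps. Two finite measures agreeing on
    them are equal. *)
Lemma normal_to_point_image A : measurable (A : set SM) ->
  sigma (T @^-1` A) = mu A.
Proof.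
have mT := measurable_normal_to_point crho rho0.
pose nu := measure_function_pushforward__canonical__measure_function_Measure (@sigma R n) mT.
pose G : set (set SM) := [set F | exists2 f : S -> R, continuous f & F = sublevel f].
move=> mA; apply: (@measure_unique _ _ _ G (fun=> setT) _ _ _ _ nu mu) => //.
- apply/seteqP; split.
    rewrite measurable_SphE; apply: sub_smallest2r; first exact: smallest_sigma_algebra.
    move=> _ [i [c ->]]; exists (fun N => sv N 0 i - c).
      by apply: continuous_sub; [exact: continuous_sv_coord|exact: cst_continuous].
    by apply/funext => N /=; rewrite subr_le0.
  apply: smallest_sub; first exact: sigma_algebra_measurable.
  move=> _ [f cf ->]; apply: measurable_closed_Sph.
  by apply: closed_fun_le => //; exact: cst_continuous.
- move=> _ _ [f cf ->] [g cg ->]; exists (fun x => Num.max (f x) (g x)).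
    exact: continuous_maxr.
  by apply/funext => x /=; rewrite ge_max; apply/propext; split => [[-> ->]|/andP].
- move=> _; exists (cst 0); first exact: cst_continuous.
  by apply/funext => x /=; rewrite lexx propeqE.
- by rewrite bigcup_const//; exists 0%N.
- by move=> _ [f cf ->]; rewrite sublevel_mass.
- by move=> _; exact: sigma_lty.
Qed.

End Variation.
End SphIntegrals.

(** * Couplings *)

Section Couplings.
Context {R : realType} {n : nat}.
Local Notation S := (Sph R n).
Local Notation SM := (SphM R n).
Variables (mu : {measure set SM -> \bar R}) (h rho : S -> R).
Hypotheses (mufin : (mu setT < +oo)%E) (hA : admissible h rho).

Let ch : continuous h. Proof. by case: hA. Qed.
Let crho : continuous rho. Proof. by case: hA => _ []. Qed.
Let h0 N : 0 < h N. Proof. by case: hA => _ [_ []]. Qed.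
Let rho0 x : 0 < rho x. Proof. by case: hA => _ [_ [_ []]]. Qed.

Definition log_ratio (p : SM * SM) : R := ln (h p.2) - ln (rho p.1).

Lemma cost_le_log_ratio p : (cost p <= (log_ratio p)%:E)%E.
Proof.
rewrite /cost; case: ifPn => [p0|_]; last exact: leNye.
by rewrite lee_fin; case: hA => _ [_ [_ [_ ]]]; exact.
Qed.

Lemma measurable_sph_dot :
  measurable_fun setT (fun p : SM * SM => dot (sv p.1) (sv p.2)).
Proof.
apply: measurable_sum => i; apply: measurable_funM.
  apply: (measurableT_comp (f := fun x : SM => sv x 0 i)) => //.
  by have [] := continuous_mbounded (@continuous_sv_coord R n i).
apply: (measurableT_comp (f := fun x : SM => sv x 0 i)) => //.
by have [] := continuous_mbounded (@continuous_sv_coord R n i).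
Qed.

Lemma measurable_cost : measurable_fun setT (@cost R n).
Proof.
apply: measurable_fun_ifT.
- apply: measurable_fun_ltr; [exact: measurable_cst|exact: measurable_sph_dot].
- apply/measurable_EFinP; apply: measurableT_comp;
  [exact: measurable_ln|exact: measurable_sph_dot].
- exact: measurable_cst.
Qed.

Let bh := continuous_mbounded (continuous_ln_comp ch h0).
Let br := continuous_mbounded (continuous_ln_comp crho rho0).

Variable g : {measure set (SM * SM) -> \bar R}.
Hypothesis gC : couplings mu g.

Let gfin : (g setT < +oo)%E.
Proof. by rewrite -setXTT (gC measurableT).1. Qed.

Lemma integrable_log_ratio : g.-integrable setT (EFin \o log_ratio).
Proof.
rewrite (_ : EFin \o _ = fun p => ((ln (h p.2))%:E - (ln (rho p.1))%:E)%E)//.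
apply: integrableB => //.
  exact: (mbounded_integrable gfin (mbounded_comp (@measurable_snd _ _ SM SM) bh)).
exact: (mbounded_integrable gfin (mbounded_comp (@measurable_fst _ _ SM SM) br)).
Qed.

(** The integrand is a sum of a function of each variable, so only the marginals of the coupling
    matter. *)
Lemma integral_log_ratio : (\int[g]_p (log_ratio p)%:E = Qfun mu h rho)%E.
Proof.
under eq_integral do rewrite EFinB.
rewrite integralB_EFin//; first last.
- exact: (mbounded_integrable gfin (mbounded_comp (@measurable_fst _ _ SM SM) br)).
- exact: (mbounded_integrable gfin (mbounded_comp (@measurable_snd _ _ SM SM) bh)).
congr (_ - _)%E.
  apply: (integral_marginal (@measurable_snd _ _ SM SM) gfin bh) => A mA.
  apply: etrans (gC mA).2; by congr (g _); apply/seteqP; split => -[x y]//= -[].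
apply: (integral_marginal (@measurable_fst _ _ SM SM) gfin br) => A mA.
apply: etrans (gC mA).1; by congr (g _); apply/seteqP; split => -[x y]//= -[].
Qed.

(** Weak duality. Since [cost] takes the value [-oo] and may fail to be integrable, positive and
    negative parts are compared separately. *)
Lemma Cost_le_Qfun : (Cost g <= Qfun mu h rho)%E.
Proof.
rewrite -integral_log_ratio /Cost integralE [leRHS]integralE.
have mlr := measurable_int _ integrable_log_ratio.
apply: leeB; apply: ge0_le_integral => //.
- apply: measurable_funepos; exact: measurable_cost.
- exact: measurable_funepos.
- by move=> p _; apply: (@funepos_le _ _ setT); rewrite ?inE// => q _;
  exact: cost_le_log_ratio.
- exact: measurable_funeneg.
- apply: measurable_funeneg; exact: measurable_cost.
- by move=> p _; apply: (@funeneg_le _ _ setT); rewrite ?inE// => q _;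
  exact: cost_le_log_ratio.
Qed.

(** The equality case of weak duality: the coupling charges only points where the pointwise bound on
    the cost is attained. *)
Lemma Cost_eq_Qfun (Z : set (SM * SM)) : measurable Z -> g (~` Z) = 0%E ->
  (forall p, Z p -> cost p = (log_ratio p)%:E) -> Cost g = Qfun mu h rho.
Proof.
move=> mZ gZ Zcost; rewrite -integral_log_ratio; apply: ae_eq_integral => //.
- exact: measurable_cost.
- exact: measurable_int integrable_log_ratio.
- exists (~` Z); split => //; first exact: measurableC.
  by move=> p /= np; apply: contra_not np => Zp _; exact: Zcost.
Qed.

End Couplings.

(** * The optimal coupling and the equality of values *)

Unset Implicit Arguments. Set Strict Implicit.

Theorem theorem11 (R : realType) (n : nat) (hn : (1 <= n)%N)
  (mu : {measure set (SphM R n) -> \bar R})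
  (hmu_tot : mu [set: SphM R n] = sigma [set: SphM R n])
  (hAlex : forall w : set (SphM R n), measurable w -> w !=set0 ->
     sph_convex w -> w <> [set: SphM R n] ->
     (sigma (polar w) < mu (~` w))%E)
  (h rho : Sph R n -> R)
  (hA : admissible h rho)
  (hmin : forall h' rho' : Sph R n -> R, admissible h' rho' ->
     (Qfun mu h rho <= Qfun mu h' rho')%E) :
  exists g : {measure set (SphM R n * SphM R n) -> \bar R},
    couplings mu g /\
    Cost g = ereal_sup [set Cost g' | g' in couplings mu] /\
    Qfun mu h rho = Cost g.
Proof.
have mufin : (mu setT < +oo)%E by rewrite hmu_tot sigma_lty.
have [ch [crho [h0 [rho0 hrho]]]] := hA.
pose H N := radial_support rho setT (sv N).
have adm : admissible H rho by exact: admissible_radial_support.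
have cH : continuous H by exact: continuous_support_function.
have H0 N : 0 < H N by exact: radial_support_gt0.
(* Admissibility of [(h, rho)] at a maximising [x] gives [H <= h], so passing to [H] cannot raise
   the functional; minimality excludes a decrease. *)
have HQ : Qfun mu h rho = Qfun mu H rho.
  apply/eqP; rewrite eq_le hmin//=; apply: leeB => //.
  have sfin : (@sigma R n setT < +oo)%E by exact: sigma_lty.
  apply: le_integral => //.
  - exact: (mbounded_integrable sfin (continuous_mbounded (continuous_ln_comp cH H0))).
  - exact: (mbounded_integrable sfin (continuous_mbounded (continuous_ln_comp ch h0))).
  move=> N _; rewrite lee_fin.
  have [x _ [HE _]] := radial_support_max crho (sv N) closedT Sph_setT_neq0.
  have d0 : 0 < dot (sv x) (sv N) by have := H0 N; rewrite /H HE pmulr_rgt0.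
  by rewrite /H HE lnM ?posrE// addrC -lerBrDr hrho.
have Hmin h' rho' : admissible h' rho' -> (Qfun mu H rho <= Qfun mu h' rho')%E.
  by rewrite -HQ; exact: hmin.
have mT := measurable_normal_to_point crho rho0.
have TE := normal_to_point_image mufin crho rho0 Hmin hmu_tot.
have mphi := measurable_fun_pair mT (@measurable_id _ _ setT).
pose g : {measure set (SphM R n * SphM R n) -> \bar R} :=
  measure_function_pushforward__canonical__measure_function_Measure (@sigma R n) mphi.
have gC : couplings mu g.
  move=> U mU; split; rewrite /g/= /pushforward.
    by rewrite -TE//; congr (sigma _); apply/seteqP; split => N //= -[].
  by congr (sigma _); apply/seteqP; split => N //= -[].
have Qg : Cost g = Qfun mu H rho.
  (* [G] is nonpositive everywhere by definition of the support function, so the set [Z] where it is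
     nonnegative is exactly the contact set. *)
  pose G (p : SphM R n * SphM R n) := rho p.1 * dot (sv p.1) (sv p.2) - H p.2.
  have mG : measurable_fun setT G.
    have [mr _] := continuous_mbounded crho; have [mH _] := continuous_mbounded cH.
    apply: measurable_funB; last exact: (measurableT_comp mH).
    by apply: measurable_funM; [exact: (measurableT_comp mr)|exact: measurable_sph_dot].
  pose Z := G @^-1` `[0, +oo[%classic.
  have mZ : measurable Z by rewrite -[Z]setTI; exact: mG.
  apply: (Cost_eq_Qfun mufin adm gC mZ) => [|[x N]].
    (* The graph of the transport map leaves the contact set only over the null set [nonunique]. *)
    apply/eqP; rewrite eq_le measure_ge0 andbT -(sigma_nonunique crho).
    have mphiZ : measurable ((fun N => (normal_to_point rho N, N)) @^-1` (~` Z) : set (SphM R n)).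
      by rewrite -[X in measurable X]setTI; exact: (mphi measurableT _ (measurableC mZ)).
    apply: (le_measure (@sigma R n)); rewrite ?inE//.
      exact: measurable_nonunique.
    move=> N /= ZN; apply: contrapT => /normal_to_point_contact xN.
    by apply: ZN; rewrite /Z/= in_itv/= andbT subr_ge0 /H xN.
  rewrite /Z/= in_itv/= andbT subr_ge0 /= => HN.
  have xN : rho x * dot (sv x) (sv N) = H N.
    by apply/eqP; rewrite eq_le HN andbT; exact: (radial_support_ub crho _ closedT).
  have d0 : 0 < dot (sv x) (sv N) by have := H0 N; rewrite -xN pmulr_rgt0.
  by rewrite /cost /log_ratio/= d0 -xN lnM ?posrE// addrAC subrr add0r.
exists g; split => //; split; last by rewrite HQ Qg.
apply/eqP; rewrite eq_le; apply/andP; split.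
  by apply: ereal_sup_ubound; exists g.
by apply: ge_ereal_sup => _ [g' g'C <-]; rewrite Qg; exact: Cost_le_Qfun.
Qed.
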